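(* Let $\lambda\approx1.5214$ be the real root and $\mu\approx-0.761+0.858i$ a complex root of $t^3-t-2$, and put $\sigma=\log_{|\mu|}\lambda\approx3.068$. Let $\mathbf Q=\bigoplus\mathbf Q_{n_1n_2n_3}$ be the $\mathbb N_0^3$-grading of $\mathbf Q=\mathrm{Lie}(v_0,v_1,v_2)$ by multidegree in $v_0,v_1,v_2$. For $(n_1,n_2,n_3)$ put $Y_1=n_1+n_2\lambda+n_3\lambda^2$, $Y_2=\operatorname{Re}(n_1+n_2\mu+n_3\mu^2)$, $Y_3=\operatorname{Im}(n_1+n_2\mu+n_3\mu^2)$. Then for every $(n_1,n_2,n_3)$ with $\mathbf Q_{n_1n_2n_3}\neq0$ (i.e. for the multidegree of every standard monomial of $\mathbf Q$), $$\sqrt{Y_2^2+Y_3^2}<14\,Y_1^{1/\sigma}.$$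
   Context: $\Lambda$ is the Grassmann algebra over a field $K$ on odd generators $x_0,x_1,\dots$; $x_i$ acts by left multiplication; $\partial_i$ is the odd superderivation with $\partial_i(x_j)=\delta_{ij}$; pivot elements $v_i=\sum_{k\ge0}\big(\prod_{n=0}^{k-1}x_{i+3n}x_{i+3n+1}\big)\partial_{i+3k}$. $\mathbf Q$ is the Lie subsuperalgebra of $(\operatorname{End}\Lambda)^{(-)}$ generated by $v_0,v_1,v_2$ (closed under squaring of odd elements in characteristic $2$); $\mathbf Q_{n_1n_2n_3}$ is the span of Lie products with $n_1,n_2,n_3$ occurrences of $v_0,v_1,v_2$. *)

(* Defs.v *)
From mathcomp Require Import all_boot all_algebra.
Set Implicit Arguments. Unset Strict Implicit. Unset Printing Implicit Defensive.
Import GRing.Theory.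
Local Open Scope ring_scope.

Section Grassmann.
Variable K : fieldType.

(* A basis monomial x_S = x_{s_1} x_{s_2} ... x_{s_k} of the Grassmann
   algebra Lambda, represented by the strictly increasing list S = [s_1;..;s_k]. *)
Definition mono := seq nat.
Definition is_mono (S : mono) : bool := sorted ltn S.

(* An element of Lambda: a finite formal K-linear combination of basis monomials. *)
Definition elt := seq (K * mono).

Definition coef (f : elt) (w : mono) : K := \sum_(p <- f | p.2 == w) p.1.

(* A K-linear endomorphism of Lambda, given by its values on basis monomials. *)
Definition op := mono -> elt.

Definition ext (A : op) (f : elt) : elt :=
  flatten [seq [seq (p.1 * q.1, q.2) | q <- A p.2] | p <- f].

Definition opcomp (A B : op) : op := fun m => ext A (B m).
Definition opadd (A B : op) : op := fun m => A m ++ B m.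
Definition opscale (c : K) (A : op) : op := fun m => [seq (c * q.1, q.2) | q <- A m].
Definition idop : op := fun S => [:: (1, S)].

Definition sgn_before (i : nat) (S : mono) : K := (-1) ^+ count (fun j => j < i)%N S.

(* left multiplication by x_i *)
Definition xop (i : nat) : op := fun S =>
  if i \in S then [::] else [:: (sgn_before i S, sort leq (i :: S))].

(* the odd superderivation d_i with d_i(x_j) = delta_ij *)
Definition dop (i : nat) : op := fun S =>
  if i \in S then [:: (sgn_before i S, rem i S)] else [::].

Definition pref (i k : nat) : op :=
  foldr (fun n A => opcomp (xop (i + 3 * n)) (opcomp (xop (i + 3 * n).+1) A))
        idop (iota 0 k).

(* pivot element v_i = sum_{k>=0} (prod_{n<k} x_{i+3n} x_{i+3n+1}) d_{i+3k}.
   On a basis monomial x_S only the terms with i+3k in S are nonzero, and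
   those have k <= sumn S, so the infinite sum is the finite sum below. *)
Definition vop (i : nat) : op := fun S =>
  flatten [seq opcomp (pref i k) (dop (i + 3 * k)) S | k <- iota 0 (sumn S).+1].

Definition op_nonzero (A : op) : Prop :=
  exists S w : mono, is_mono S /\ coef (A S) w != 0.

End Grassmann.

(* Lie (super)words in the generators v_0, v_1, v_2: brackets, and squares
   of odd elements (needed in characteristic 2). *)
Inductive lword := LGen of 'I_3 | LBr of lword & lword | LSq of lword.

Fixpoint mdeg (w : lword) : nat * nat * nat :=
  match w with
  | LGen j => if val j == 0%N then (1, 0, 0)%N
              else if val j == 1%N then (0, 1, 0)%N else (0, 0, 1)%N
  | LBr a b => let: (a1, a2, a3) := mdeg a in let: (b1, b2, b3) := mdeg b in
               (a1 + b1, a2 + b2, a3 + b3)%N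
  | LSq a => let: (a1, a2, a3) := mdeg a in (a1.*2, a2.*2, a3.*2)%N
  end.

(* total degree; parity of w is odd (tdeg w), since every v_i is odd *)
Definition tdeg (w : lword) : nat := let: (a1, a2, a3) := mdeg w in (a1 + a2 + a3)%N.

Fixpoint wf (w : lword) : bool :=
  match w with
  | LGen _ => true
  | LBr a b => wf a && wf b
  | LSq a => wf a && odd (tdeg a)
  end.

Fixpoint eval (K : fieldType) (w : lword) : op K :=
  match w with
  | LGen j => vop K (val j)
  | LBr a b =>
      let s : K := if odd (tdeg a) && odd (tdeg b) then 1 else -1 in
      opadd (opcomp (eval K a) (eval K b)) (opscale s (opcomp (eval K b) (eval K a)))
  | LSq a => opcomp (eval K a) (eval K a)
  end.

(* Q_{n1 n2 n3} <> 0: Q_{n} is the span of the Lie products of multidegree n,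
   so it is nonzero iff one of these products is a nonzero operator. *)
Definition Qcomp_nonzero (K : fieldType) (n : nat * nat * nat) : Prop :=
  exists w : lword, [/\ wf w, mdeg w = n & op_nonzero (eval K w)].

(* Main.v *)
(* If v_i has weight a_i, then x_i has weight -a_i, and v_i = d_i + x_i x_{i+1} v_{i+3}
   forces a_{i+3} = a_{i+1} + 2 a_i; the functionals Y_1 and Y_2 + i Y_3 send a_i to
   lambda^i and mu^i.  Elements of Q are superderivations, hence determined by their
   values on the generators x_j.  The set of terms x_A d_j occurring in the elements
   x_r v_n, with r contained in {0,..,n-3} or in {0,..,n-5} + {n-2}, is closed under
   (x_A d_i, x_B d_j) |-> x_A d_i(x_B) d_j, so every nonzero component of Q has weight
   a_n - sum_{i in r} a_i for such n and r.  Geometric sums then give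
   Y_1 >= 0.13 lambda^n >= lambda^(n-5) and |Y_2 + i Y_3| <= 6.5 |mu|^n, while
   (lambda^m)^(1/sigma) = |mu|^m and 6.5 |mu|^5 < 14. *)
From HB Require Import structures.
Require Import Defs.
From Stdlib Require Import Reals Lra.
From Coquelicot Require Import Coquelicot.
From mathcomp Require Import all_boot all_algebra zify.
From mathcomp Require Import boolp functions.
Set Implicit Arguments. Unset Strict Implicit. Unset Printing Implicit Defensive.
Import GRing.Theory.

(** * Shapes of the terms [x_A d_j] *)

Section PivotShapes.
Local Open Scope nat_scope.

(* Membership in the index set of [prod_{q<k} x_{n+3q} x_{n+3q+1}]. *)
Definition in_pref n k x : bool := [&& n <= x, x < n + 3 * k & (x - n) %% 3 < 2].

(* The term [x_A d_j] occurs in the expansion of [x_r v_n], where the tail [r]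
   either lies in [0, n-3], or lies in [0, n-5] with [n-2] adjoined. *)
Definition pivot_shape (A : seq nat) (j : nat) : Prop :=
  exists n k, [/\ j = n + 3 * k,
    forall x, in_pref n k x -> x \in A &
    (forall x, x \in A -> in_pref n k x \/ x + 3 <= n) \/
    (forall x, x \in A -> [\/ in_pref n k x, x + 2 = n | x + 5 <= n])].

Lemma in_pref_cases {m l i} : in_pref m l i ->
  exists2 q, q < l & i = m + 3 * q \/ i = m + 3 * q + 1.
Proof.
rewrite /in_pref => /and3P[h1 h2 h3]; exists ((i - m) %/ 3); first lia.
lia.
Qed.

Lemma pivot_shape_lt A j : pivot_shape A j -> forall x, x \in A -> x + 2 <= j.
Proof.
by move=> [n [k [-> _ [H|H]]]] x /H; [case|case]; rewrite /in_pref; lia.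
Qed.

(* [x_C d_j] is the image of [x_B d_j] under letting [x_A d_i] act on the
   coefficient [x_B]; this one-sided product is already closed, so neither half
   of a bracket relies on cancellation against the other. *)
Lemma pivot_shape_comp (A B C : seq nat) (i j : nat) :
    pivot_shape A i -> pivot_shape B j -> i \in B ->
    (forall x, x \in A -> x \in B -> x = i) ->
    (forall x, (x \in C) = (x \in A) || (x \in B) && (x != i)) ->
  pivot_shape C j.
Proof.
move=> sA sB iB dAB defC.
have ltA := pivot_shape_lt sA.
have [n [k [Di PA rA]]] := sA.
have [m [l [Dj PB rB]]] := sB.
have rA' x : x \in A -> in_pref n k x \/ x + 2 <= n.
  by case: rA => H /H; [case|case] => ?; [left|right; lia|left|right; lia|right; lia].
have rB' x : x \in B -> in_pref m l x \/ x + 2 <= m.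
  by case: rB => H /H; [case|case] => ?; [left|right; lia|left|right; lia|right; lia].
have inC x : x \in C -> x \in A \/ x \in B /\ x <> i.
  by rewrite defC => /orP[|/andP[? /eqP]]; [left|right].
have Cin x : (x \in A) \/ (x \in B /\ x <> i) -> x \in C.
  by rewrite defC => -[->//|[-> /eqP ->]]; rewrite orbT.
case: (boolP (in_pref m l i)) => [iP|iNP].
  have [q ltq Di'] := in_pref_cases iP.
  (* Residues mod 3 make the prefix that starts later meet the other one: a nonzero [q] (first two
     cases) or [k] (last two) would give [A] and [B] a common index other than [i]. Hence [i] is
     [m], [m + 1] or [n]. The prefix restarts just after the pair containing [i], and the other
     index of that pair joins the tail. *)
  have [le_nm|lt_mn] := leqP n m; case: Di' => Di'.
  - have q0 : q = 0.
      case: q ltq Di' => // q ltq Di'; suff: m = i by lia.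
      by apply: dAB; [apply: PA|apply: PB]; rewrite /in_pref; lia.
    exists (m + 3), (l - 1); split; first lia.
      move=> x hx; apply: Cin; right.
      by split; [apply: PB|]; move: hx; rewrite /in_pref; lia.
    right=> x /inC[/ltA|[/rB'[] hx xi]] ; first by constructor 3; lia.
      have [e|ne] := eqVneq x (m + 1); first by constructor 2; lia.
      by constructor 1; move: hx; rewrite /in_pref; lia.
    by constructor 3; lia.
  - have q0 : q = 0.
      case: q ltq Di' => // q ltq Di'; suff: m + 1 = i by lia.
      by apply: dAB; [apply: PA|apply: PB]; rewrite /in_pref; lia.
    exists (m + 3), (l - 1); split; first lia.
      move=> x hx; apply: Cin; right.
      by split; [apply: PB|]; move: hx; rewrite /in_pref; lia.
    left=> x /inC[/ltA|[/rB'[] hx xi]] ; first by right; lia.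
      have [e|ne] := eqVneq x m; first by right; lia.
      by left; move: hx; rewrite /in_pref; lia.
    by right; lia.
  - have k0 : k = 0.
      case: k Di PA {rA rA'} => // k Di PA; suff: n = i by lia.
      by apply: dAB; [apply: PA|apply: PB]; rewrite /in_pref; lia.
    exists (n + 3), (l - q - 1); split; first lia.
      move=> x hx; apply: Cin; right.
      by split; [apply: PB|]; move: hx; rewrite /in_pref; lia.
    right=> x /inC[/ltA|[/rB'[] hx xi]] ; first by constructor 3; lia.
      have [e|ne] := eqVneq x (n + 1); first by constructor 2; lia.
      have [lt_xn|le_nx] := ltnP x n; last first.
        by constructor 1; move: hx; rewrite /in_pref; lia.
      by constructor 3; move: hx; rewrite /in_pref; lia.
    by constructor 3; lia.
  - have k0 : k = 0.
      case: k Di PA {rA rA'} => // k Di PA; suff: n = i by lia.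
      by apply: dAB; [apply: PA|apply: PB]; rewrite /in_pref; lia.
    exists (n + 2), (l - q - 1); split; first lia.
      move=> x hx; apply: Cin; right.
      by split; [apply: PB|]; move: hx; rewrite /in_pref; lia.
    left=> x /inC[/ltA|[/rB'[] hx xi]] ; first by right; lia.
      have [lt_xn|le_nx] := ltnP x n; last first.
        by left; move: hx; rewrite /in_pref; lia.
      by right; lia.
    by right; lia.
(* Here [i] lies in the tail of [B], so the prefix survives, and the entries of [A] are at most
   [i - 2]. Replacing [i = m - 2] turns a tail of the second kind into one of the first. *)
exists m, l; split=> //.
  by move=> x hx; apply: Cin; right; split; [exact: PB|move=> xi; move: iNP; rewrite -xi hx].
case: rB => rB.
  have [e|lei] := rB _ iB; first by rewrite e in iNP.
  left=> x /inC[/ltA|[/rB[] hx xi]]; [right; lia|by left|right; lia].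
have [e|e|lei] := rB _ iB; first by rewrite e in iNP.
  left=> x /inC[/ltA|[/rB[] hx xi]]; [right; lia|by left|lia|right; lia].
by right=> x /inC[/ltA|[/rB[] hx xi]];
  [constructor 3; lia|constructor 1|constructor 2; lia|constructor 3; lia].
Qed.

(** * Weights of prefixes, and their removal from a shape *)

Definition pref_seq n k : seq nat :=
  foldr (fun q s => [:: n + 3 * q, (n + 3 * q).+1 & s]) [::] (iota 0 k).

(* Satisfied by the weights: [v_i = d_i + x_i x_{i+1} v_{i+3}] is homogeneous. *)
Definition pivot_rec (f : nat -> nat) : Prop :=
  forall i, f (i + 3) = f (i + 1) + 2 * f i.

Lemma foldr_pref_cat n (s t : seq nat) :
  foldr (fun q s => [:: n + 3 * q, (n + 3 * q).+1 & s]) t s =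
  foldr (fun q s => [:: n + 3 * q, (n + 3 * q).+1 & s]) [::] s ++ t.
Proof. by elim: s => //= q s ->. Qed.

Lemma pref_seqS n k :
  pref_seq n k.+1 = pref_seq n k ++ [:: n + 3 * k; (n + 3 * k).+1].
Proof. by rewrite /pref_seq -[in LHS](addn1 k) iotaD foldr_cat foldr_pref_cat. Qed.

Lemma mem_pref_seq n k x : (x \in pref_seq n k) = in_pref n k x.
Proof.
elim: k => [|k IHk]; first by rewrite in_nil /in_pref; lia.
by rewrite pref_seqS mem_cat !inE IHk /in_pref; lia.
Qed.

Lemma uniq_pref_seq n k : uniq (pref_seq n k).
Proof.
elim: k => // k IHk; rewrite pref_seqS cat_uniq IHk /= !inE !orbF.
by rewrite !mem_pref_seq /in_pref; lia.
Qed.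

Lemma size_pref_seq n k : size (pref_seq n k) = 2 * k.
Proof. by elim: k => // k IHk; rewrite pref_seqS size_cat IHk /=; lia. Qed.

(** The sum telescopes: adding the pair [f i + f (i + 1)] to [f i] gives [f (i + 3)]. *)
Lemma sum_pref_seq f n k : pivot_rec f ->
  f n + \sum_(a <- pref_seq n k) f a = f (n + 3 * k).
Proof.
move=> fr; elim: k => [|k IHk]; first by rewrite big_nil muln0 !addn0.
rewrite pref_seqS big_cat /= addnA IHk !big_cons big_nil /=.
have -> : n + 3 * k.+1 = n + 3 * k + 3 by lia.
by rewrite fr addn1; lia.
Qed.

Lemma pivot_shape_pref n k : pivot_shape (pref_seq n k) (n + 3 * k).
Proof.
exists n, k; split=> // [x|]; first by rewrite mem_pref_seq.
by left=> x; rewrite mem_pref_seq; left.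
Qed.

Definition tail_shape (n : nat) (r : seq nat) : Prop :=
  (forall x, x \in r -> x + 3 <= n) \/
  (forall x, x \in r -> x + 2 = n \/ x + 5 <= n).

(** The entries of [A] from [n] on are exactly the prefix, whose weight telescopes to [f j - f n].
    Only the entries below [n] remain to be estimated. *)
Lemma pivot_shape_tail (A : seq nat) (j : nat) : uniq A -> pivot_shape A j ->
  exists n r, [/\ uniq r, tail_shape n r &
    forall f d, pivot_rec f -> d + \sum_(a <- A) f a = f j ->
      d + \sum_(a <- r) f a = f n].
Proof.
move=> uA [n [k [-> PA rA]]]; exists n, [seq a <- A | a < n].
split; first exact: filter_uniq.
  case: rA => rA; [left|right] => x; rewrite mem_filter => /andP[ltx /rA].
    by case=> //; rewrite /in_pref; lia.
  by case=> [|->|]; [rewrite /in_pref; lia|left|right].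
move=> f d fr; rewrite -(sum_pref_seq n k fr) big_filter.
rewrite (bigID (fun a => a < n)) /=.
have -> : \sum_(a <- A | ~~ (a < n)) f a = \sum_(a <- pref_seq n k) f a.
  rewrite -big_filter; apply: perm_big.
  apply: uniq_perm; [exact: filter_uniq|exact: uniq_pref_seq|move=> x].
  rewrite mem_filter mem_pref_seq; apply/andP/idP => [[nltx]|hx].
    by case: rA => rA /rA[]//; lia.
  by split; [move: hx; rewrite /in_pref; lia|exact: PA].
by rewrite addnA => /eqP; rewrite eqn_add2r => /eqP.
Qed.

End PivotShapes.

(** * Superderivations *)

Section Superderivations.
Local Open Scope ring_scope.
Variables (K : fieldType) (V : lmodType K) (X : nat -> {linear V -> V}).
Hypothesis X_sq : forall i v, X i (X i v) = 0.
Hypothesis X_anti : forall i j v, X i (X j v) = - X j (X i v).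

Fixpoint Xprod (A : seq nat) (v : V) : V :=
  if A is a :: A' then X a (Xprod A' v) else v.

Definition in_span (P : seq nat -> Prop) (L : V -> V) : Prop :=
  exists2 s : seq (K * seq nat), (forall p, p \in s -> P p.2) &
    forall v, L v = \sum_(p <- s) p.1 *: Xprod p.2 v.

(** The Leibniz rule as a supercommutator: [L] plays the role of multiplication by the value of [D]
    at the generator [x_i], and [P i] restricts the monomials of that value. *)
Definition superder (P : nat -> seq nat -> Prop) (b : bool) (D : V -> V) : Prop :=
  forall i, exists2 L, in_span (P i) L &
    forall v, D (X i v) = (-1) ^+ b *: X i (D v) + L v.

Lemma Xprod_is_linear A : linear (Xprod A).
Proof. by elim: A => //= a A IH c u v; rewrite IH linearP. Qed.

HB.instance Definition _ A :=
  GRing.isLinear.Build K V V *:%R (Xprod A) (@Xprod_is_linear A).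

Lemma Xprod_cat A B v : Xprod (A ++ B) v = Xprod A (Xprod B v).
Proof. by elim: A => //= a A ->. Qed.

Lemma X_Xprod i A v : X i (Xprod A v) = (-1) ^+ size A *: Xprod A (X i v).
Proof.
elim: A => [|a A IH] /=; first by rewrite scale1r.
by rewrite X_anti IH linearZ /= exprS mulN1r scaleNr.
Qed.

Lemma Xprod_non_uniq A v : ~~ uniq A -> Xprod A v = 0.
Proof.
elim: A => //= a A IH; rewrite negb_and negbK => /orP[|/IH -> ]; last exact: linear0.
case/splitPr=> A1 A2; rewrite Xprod_cat X_Xprod /= X_sq.
by rewrite linear0 scaler0.
Qed.

Lemma in_span_sub (P Q : seq nat -> Prop) L :
  (forall A, P A -> Q A) -> in_span P L -> in_span Q L.
Proof. by move=> PQ [s sP Ls]; exists s => // p /sP /PQ. Qed.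

(** Monomials with a repeated index act as zero. Discarding them later supplies the disjointness
    hypothesis of [pivot_shape_comp]. *)
Lemma in_span_uniq P L : in_span P L -> in_span (fun A => P A /\ uniq A) L.
Proof.
move=> [s sP Ls]; exists [seq p <- s | uniq p.2] => [p|v].
  by rewrite mem_filter => /andP[? /sP].
rewrite Ls big_filter [RHS]big_mkcond; apply: eq_bigr => p _.
by case: ifPn => // /Xprod_non_uniq ->; rewrite scaler0.
Qed.

Lemma in_span0 P : in_span P (fun=> 0).
Proof. by exists [::] => // v; rewrite big_nil. Qed.

Lemma in_spanD P L M : in_span P L -> in_span P M ->
  in_span P (fun v => L v + M v).
Proof.
move=> [s sP Ls] [t tP Mt]; exists (s ++ t) => [p|v].
  by rewrite mem_cat => /orP[/sP|/tP].
by rewrite Ls Mt big_cat.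
Qed.

Lemma in_spanZ P c L : in_span P L -> in_span P (fun v => c *: L v).
Proof.
move=> [s sP Ls]; exists [seq (c * p.1, p.2) | p <- s] => [p|v].
  by case/mapP=> q /sP ? ->.
rewrite Ls big_map scaler_sumr; apply: eq_bigr => p _.
by rewrite scalerA.
Qed.

Lemma in_span_Xl P L a :
  in_span P L -> in_span (fun C => exists2 A, C = a :: A & P A) (fun v => X a (L v)).
Proof.
move=> [s sP Ls]; exists [seq (p.1, a :: p.2) | p <- s] => [p|v].
  by case/mapP=> q /sP ? ->; exists q.2.
rewrite Ls big_map linear_sum; apply: eq_bigr => p _.
by rewrite linearZ.
Qed.

Lemma in_span_Xr P L B :
  in_span P L ->
  in_span (fun C => exists2 A, C = A ++ B & P A) (fun v => L (Xprod B v)).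
Proof.
move=> [s sP Ls]; exists [seq (p.1, p.2 ++ B) | p <- s] => [p|v].
  by case/mapP=> q /sP ? ->; exists q.2.
rewrite Ls big_map; apply: eq_bigr => p _.
by rewrite Xprod_cat.
Qed.

(* The monomials that [x_B d_i] with [P i B] produces from [x_A]. *)
Definition contracted (P : nat -> seq nat -> Prop) (A C : seq nat) : Prop :=
  exists i B, [/\ i \in A, P i B & perm_eq C (B ++ rem i A)].

(** Leibniz rule on a monomial: [D] moves past one factor at a time, and each passage leaves a term
    with that factor replaced. *)
Lemma superder_Xprod P b (D : {linear V -> V}) A : superder P b D ->
  exists2 L, in_span (contracted P A) L &
    forall v, D (Xprod A v) = (-1) ^+ (b * size A) *: Xprod A (D v) + L v.
Proof.
move=> dD; elim: A => [|a A [L sL DL]].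
  exists (fun=> 0); first exact: in_span0.
  by move=> v; rewrite muln0 scale1r addr0.
have [M sM DM] := dD a.
exists (fun v => (-1) ^+ b *: X a (L v) + M (Xprod A v)); last first.
  move=> v /=; rewrite DM DL linearD linearZ /= scalerDr scalerA -exprD mulnS.
  by rewrite addrA.
apply: in_spanD.
  apply: in_spanZ; apply: in_span_sub (in_span_Xl a sL) => C [C' ->].
  move=> [i [B [iA PB pC]]]; exists i, B; split=> //.
    by rewrite inE iA orbT.
  apply: perm_trans (_ : perm_eq _ (a :: B ++ rem i A)) _.
    by rewrite perm_cons.
  (* If [a = i], then [rem] deletes the head instead of the copy inside [A]; the two results agree
     up to order. *)
  rewrite -cat1s perm_catCA perm_cat2l /=; case: eqP => [ai|//].
  by rewrite perm_sym -{1}ai perm_to_rem // ai.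
apply: in_span_sub (in_span_Xr A sM) => C [B -> PB].
by exists a, B; rewrite mem_head /= eqxx.
Qed.

(** The common parity [c] of the monomials in [Q] gives all terms the same sign, so the rule passes
    to linear combinations. *)
Lemma superder_span P Q R b c (D : {linear V -> V}) L : superder P b D ->
  in_span Q L -> (forall A, Q A -> odd (size A) = c) ->
  (forall A C, Q A -> contracted P A C -> uniq C -> R C) ->
  exists2 M, in_span R M &
    forall v, D (L v) = (-1) ^+ (b && c) *: L (D v) + M v.
Proof.
move=> dD [s sQ Ls] Qc cl.
suff [M sM DM] : exists2 M, in_span R M & forall v,
    D (\sum_(p <- s) p.1 *: Xprod p.2 v) =
    (-1) ^+ (b && c) *: (\sum_(p <- s) p.1 *: Xprod p.2 (D v)) + M v.
  by exists M => // v; rewrite !Ls.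
elim: s sQ {L Ls} => [|p s IH] sQ.
  exists (fun=> 0); first exact: in_span0.
  by move=> v; rewrite !big_nil linear0 scaler0 addr0.
have [|M sM DM] := IH; first by move=> q qs; apply: sQ; rewrite inE qs orbT.
have Qp : Q p.2 by apply: sQ; rewrite mem_head.
have [N sN DN] := superder_Xprod p.2 dD.
exists (fun v => p.1 *: N v + M v).
  apply: in_spanD => //; apply: in_spanZ.
  by apply: in_span_sub (in_span_uniq sN) => C [? ?]; apply: cl Qp _ _.
move=> v; rewrite !big_cons linearD linearZ /= DM DN scalerDr.
have -> : (-1) ^+ (b * size p.2) = (-1) ^+ (b && c) :> K.
  by rewrite -signr_odd oddM (Qc _ Qp) oddb.
rewrite !scalerDr !scalerA [p.1 * _]mulrC -!addrA; congr (_ + _).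
by rewrite addrCA.
Qed.

Lemma addr_cancel4 (U : zmodType) (a b x x' y y' m l : U) :
  x + x' = 0 -> y + y' = 0 ->
  a + x + (y + m) + (b + y' + (x' + l)) = a + b + (m + l).
Proof.
move=> xx yy; rewrite addrACA [a + x + _]addrACA [y + m + _]addrACA.
rewrite -!addrA; congr (_ + (_ + _)).
by rewrite [y' + _]addrA [y' + y]addrC yy add0r addrA xx add0r.
Qed.

Section Bracket.
Variables (P Q R : nat -> seq nat -> Prop) (b c : bool) (D E : {linear V -> V}).
Hypotheses (dD : superder P b D) (dE : superder Q c E).
Hypothesis P_odd : forall i A, P i A -> odd (size A) = ~~ b.
Hypothesis Q_odd : forall i A, Q i A -> odd (size A) = ~~ c.
Hypothesis PQR : forall i A C, Q i A -> contracted P A C -> uniq C -> R i C.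
Hypothesis QPR : forall i A C, P i A -> contracted Q A C -> uniq C -> R i C.

Lemma superder_bracket :
  superder R (b (+) c)
    (fun v => D (E v) + (if b && c then 1 else -1) *: E (D v)).
Proof.
move=> i; have [L sL DL] := dD i; have [M sM EM] := dE i.
have [M' sM' DM] := superder_span dD sM (@Q_odd i) (@PQR i).
have [L' sL' EL] := superder_span dE sL (@P_odd i) (@QPR i).
exists (fun v => M' v + (if b && c then 1 else -1) *: L' v).
  by apply: in_spanD => //; apply: in_spanZ.
move=> v; rewrite EM DL !linearD !linearZ /= DL EM DM EL.
(* The cross terms [L (E v)] and [M (D v)] each occur twice with opposite signs, for every choice of
   parities. *)
case: (b); case: (c) => /=;
  rewrite ?(expr0, expr1, scale1r, scaleN1r, scalerDr, opprD, opprK);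
  by apply: addr_cancel4; rewrite ?subrr ?addNr.
Qed.

End Bracket.

(** The two terms [L (D v)] cancel without any division by 2, so the argument is valid in every
    characteristic. *)
Lemma superder_square P R (D : {linear V -> V}) : superder P true D ->
  (forall i A, P i A -> odd (size A) = false) ->
  (forall i A C, P i A -> contracted P A C -> uniq C -> R i C) ->
  superder R false (fun v => D (D v)).
Proof.
move=> dD P_odd PR i; have [L sL DL] := dD i.
have [M sM DM] := superder_span dD sL (@P_odd i) (@PR i).
exists M => // v; rewrite DL linearD linearZ /= DL DM /= scale1r expr1.
by rewrite scaleN1r scaleN1r opprD opprK scale1r addrA subrK.
Qed.

End Superderivations.

(** * The transposed action on the Grassmann algebra *)

Section DualAction.
Local Open Scope ring_scope.
Variable K : fieldType.

Definition smono := {S : seq nat | is_mono S}.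
Definition smono_nil : smono := exist _ [::] isT.
(* Junk value [smono_nil] on lists that are not strictly increasing. *)
Definition to_smono (w : seq nat) : smono := insubd smono_nil w.
Definition dual := smono -> K^o.

Lemma dual_oppE (u : dual) S : (- u) S = - (u S : K).
Proof. by []. Qed.

Lemma dual_addE (u v : dual) S : (u + v) S = (u S : K) + (v S : K).
Proof. by []. Qed.

Lemma dual_scaleE c (u : dual) S : (c *: u) S = c * (u S : K).
Proof. by []. Qed.

(* Transposed operators: unlike the action on formal sums, this turns the
   non-canonical representation into honest linear maps; it reverses products. *)
Definition act (A : op K) (phi : dual) : dual :=
  fun S => \sum_(p <- A (val S)) p.1 * phi (to_smono p.2).

Lemma act_is_linear A : linear (act A).
Proof.
move=> c u v; apply/funext => S; rewrite dual_addE dual_scaleE /act.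
rewrite mulr_sumr -big_split; apply: eq_bigr => p _ /=.
by rewrite dual_addE dual_scaleE mulrDr mulrCA.
Qed.

HB.instance Definition _ A :=
  GRing.isLinear.Build K dual dual *:%R (act A) (@act_is_linear A).

(** Ensures that [act] never meets the default value of [to_smono], which is what makes [act] turn
    compositions into reversed compositions. *)
Definition preserves_mono (A : op K) : Prop :=
  forall S p, is_mono S -> p \in A S -> is_mono p.2.

Lemma to_smonoK (w : seq nat) : is_mono w -> val (to_smono w) = w.
Proof. by move=> mw; rewrite /to_smono val_insubd mw. Qed.

Lemma is_mono_uniq S : is_mono S = uniq S && sorted leq S.
Proof. by rewrite /is_mono ltn_sorted_uniq_leq. Qed.

Lemma sort_leqP (s t : seq nat) : perm_eq s t -> sort leq s = sort leq t.
Proof. by move/perm_sortP; apply; [exact: leq_total|exact: leq_trans|exact: anti_leq]. Qed.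

Lemma sort_mono S : is_mono S -> sort leq S = S.
Proof. by rewrite is_mono_uniq => /andP[_]; apply: sorted_sort; exact: leq_trans. Qed.

Lemma is_mono_insert i S : is_mono S -> i \notin S -> is_mono (sort leq (i :: S)).
Proof.
rewrite !is_mono_uniq => /andP[uS _] iS; rewrite sort_uniq /= iS uS.
exact: sort_sorted leq_total _.
Qed.

Lemma is_mono_rem i S : is_mono S -> is_mono (rem i S).
Proof. by apply: subseq_sorted (rem_subseq _ _); exact: ltn_trans. Qed.

Lemma preserves_mono_comp A B :
  preserves_mono A -> preserves_mono B -> preserves_mono (opcomp A B).
Proof.
move=> pA pB S p mS /flattenP[s /mapP[q qB ->] /mapP[r rA ->]] /=.
exact: pA (pB _ _ mS qB) rA.
Qed.

Lemma preserves_mono_xop i : preserves_mono (xop K i).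
Proof.
move=> S p mS; rewrite /xop; case: ifPn => // iS; rewrite inE => /eqP -> /=.
exact: is_mono_insert.
Qed.

Lemma preserves_mono_dop i : preserves_mono (dop K i).
Proof.
move=> S p mS; rewrite /dop; case: ifPn => // iS; rewrite inE => /eqP -> /=.
exact: is_mono_rem.
Qed.

Lemma preserves_mono_foldr i (s : seq nat) : preserves_mono
  (foldr (fun n A => opcomp (xop K (i + 3 * n)) (opcomp (xop K (i + 3 * n).+1) A))
    (idop K) s).
Proof.
elim: s => [|n s IH] /=; first by move=> S p mS; rewrite inE => /eqP ->.
by do 2![apply: preserves_mono_comp; first exact: preserves_mono_xop].
Qed.

Lemma preserves_mono_vop i : preserves_mono (vop K i).
Proof.
move=> S p mS /flattenP[s /mapP[k _ ->]].
by apply: preserves_mono_comp mS; [exact: preserves_mono_foldr|exact: preserves_mono_dop].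
Qed.

Lemma act_comp A B phi : preserves_mono B ->
  act (opcomp A B) phi = act B (act A phi).
Proof.
move=> pB; apply/funext => S; rewrite /act /opcomp /ext big_flatten big_map.
apply: eq_big_seq => p pBS; rewrite big_map /= mulr_sumr to_smonoK.
  by apply: eq_bigr => q _ /=; rewrite mulrA.
exact: pB (valP S) pBS.
Qed.

Lemma act_add A B phi : act (opadd A B) phi = act A phi + act B phi.
Proof. by apply/funext => S; rewrite /act /opadd big_cat. Qed.

Lemma act_scale c A phi : act (opscale c A) phi = c *: act A phi.
Proof.
apply/funext => S; rewrite dual_scaleE /act big_map mulr_sumr.
by apply: eq_bigr => p _ /=; rewrite mulrA.
Qed.

Lemma act_id phi : act (idop K) phi = phi.
Proof.
by apply/funext => S; rewrite /act big_seq1 mul1r /to_smono valKd.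
Qed.

Lemma act_xop i phi S : act (xop K i) phi S =
  if i \in val S then 0
  else sgn_before K i (val S) * phi (to_smono (sort leq (i :: val S))).
Proof. by rewrite /act /xop; case: ifP; rewrite ?big_nil ?big_seq1. Qed.

Lemma act_dop i phi S : act (dop K i) phi S =
  if i \in val S then sgn_before K i (val S) * phi (to_smono (rem i (val S)))
  else 0.
Proof. by rewrite /act /dop; case: ifP; rewrite ?big_nil ?big_seq1. Qed.

(** * Signs and the canonical anticommutation relations *)

Lemma sgn_before_perm i S T :
  perm_eq S T -> sgn_before K i S = sgn_before K i T.
Proof. by move/permP => e; rewrite /sgn_before e. Qed.

Lemma sgn_before_cons i j S :
  sgn_before K i (j :: S) = (-1) ^+ (j < i)%N * sgn_before K i S.
Proof. by rewrite /sgn_before /= exprD. Qed.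

Lemma sgn_before_sq i S : sgn_before K i S * sgn_before K i S = 1.
Proof. by rewrite /sgn_before -exprD addnn -muln2 exprM sqrr_sign. Qed.

Lemma sgn_ltn_anti (i j : nat) : i != j ->
  (-1) ^+ (i < j)%N = - (-1) ^+ (j < i)%N :> K.
Proof. by rewrite neq_ltn => /orP[] h; rewrite h ltnNge (ltnW h) /= ?opprK. Qed.

Definition Xact i : {linear dual -> dual} := act (xop K i).

Lemma XactE i phi S : Xact i phi S =
  if i \in val S then 0
  else sgn_before K i (val S) * phi (to_smono (sort leq (i :: val S))).
Proof. exact: act_xop. Qed.

Lemma Xact_sq i v : Xact i (Xact i v) = 0.
Proof.
apply/funext => S; rewrite XactE; case: ifPn => // iS.
rewrite XactE to_smonoK ?mem_sort ?mem_head ?mulr0 //.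
exact: is_mono_insert (valP S) iS.
Qed.

Lemma Xact_anti i j v : Xact i (Xact j v) = - Xact j (Xact i v).
Proof.
have [->|nij] := eqVneq i j; first by rewrite Xact_sq oppr0.
apply/funext => S; rewrite dual_oppE !XactE.
have mS := valP S; set s := val S in mS *.
case: (boolP (i \in s)) => iS; case: (boolP (j \in s)) => jS; rewrite ?XactE ?to_smonoK ?is_mono_insert //.
- by rewrite oppr0.
- by rewrite mem_sort inE iS orbT mulr0 oppr0.
- by rewrite mem_sort inE jS orbT mulr0 oppr0.
rewrite !mem_sort !inE (negPf iS) (negPf jS) [j == i]eq_sym (negPf nij) /=.
have p1 : perm_eq (sort leq (i :: s)) (i :: s) by rewrite perm_sort.
have p2 : perm_eq (sort leq (j :: s)) (j :: s) by rewrite perm_sort.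
rewrite (sgn_before_perm _ p1) (sgn_before_perm _ p2) !sgn_before_cons.
have -> : sort leq (j :: sort leq (i :: s)) = sort leq (i :: sort leq (j :: s)).
  apply: sort_leqP; apply: (@perm_trans _ [:: j, i & s]); first by rewrite perm_cons.
  rewrite perm_sym; apply: (@perm_trans _ [:: i, j & s]); first by rewrite perm_cons.
  by apply/seq.permP => a /=; rewrite addnCA.
by rewrite (sgn_ltn_anti nij) !mulNr !mulrN mulrCA !mulrA; congr (- (_ * _)); rewrite -!mulrA mulrCA.
Qed.

Lemma mono_eq (s t : seq nat) : is_mono s -> is_mono t -> s =i t -> s = t.
Proof. exact: irr_sorted_eq ltn_trans ltnn s t. Qed.

(** For [m = j] exactly one of the two products survives at each monomial, with a squared sign. For
    [m != j], insertion and deletion commute, and the order of [m] and [j] produces the minus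
    sign. *)
Lemma dop_Xact m j v :
  act (dop K m) (Xact j v) = - Xact j (act (dop K m) v) + (m == j)%:R *: v.
Proof.
apply/funext => S; rewrite dual_addE dual_oppE dual_scaleE act_dop !XactE.
have mS := valP S; have SE : S = to_smono (val S) by rewrite /to_smono valKd.
rewrite [in X in _ + X]SE {SE}; set s := val S in mS *.
have us : uniq s by move: mS; rewrite is_mono_uniq => /andP[].
have permR : m \in s -> perm_eq (m :: rem m s) s.
  by move=> ms; rewrite perm_sym perm_to_rem.
have permI : perm_eq (sort leq (j :: s)) (j :: s) by rewrite perm_sort.
have [mj|nmj] := eqVneq m j.
  rewrite -{j}mj mul1r in permI *; case: (boolP (m \in s)) => ms.
    rewrite to_smonoK ?is_mono_rem // mem_rem_uniqF // oppr0 add0r mulrA.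
    rewrite (sort_leqP (permR ms)) sort_mono // -(sgn_before_perm _ (permR ms)).
    by rewrite sgn_before_cons ltnn mul1r sgn_before_sq mul1r.
  rewrite act_dop to_smonoK ?is_mono_insert // mem_sort mem_head.
  rewrite (sgn_before_perm _ permI) sgn_before_cons ltnn mul1r mulrA.
  rewrite sgn_before_sq mul1r; suff -> : rem m (sort leq (m :: s)) = s by rewrite addNr.
  apply: mono_eq => // [|x]; first exact/is_mono_rem/is_mono_insert.
  rewrite mem_rem_uniq ?sort_uniq /= ?ms // inE mem_sort !inE.
  by case: eqVneq => // ->; rewrite (negPf ms).
rewrite mul0r addr0.
have njm : j != m by rewrite eq_sym.
case: (boolP (m \in s)) => ms; last first.
  case: (boolP (j \in s)) => js; rewrite ?oppr0 //.
  rewrite act_dop to_smonoK ?is_mono_insert // mem_sort inE (negPf nmj) (negPf ms).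
  by rewrite mulr0 oppr0.
rewrite to_smonoK ?is_mono_rem // mem_rem_uniq // inE /= njm /=.
case: (boolP (j \in s)) => js; first by rewrite mulr0 oppr0.
rewrite act_dop to_smonoK ?is_mono_insert // mem_sort inE ms orbT.
rewrite (sgn_before_perm _ permI) sgn_before_cons.
rewrite -(sgn_before_perm _ (permR ms)) sgn_before_cons ltnn mul1r.
rewrite -(sgn_before_perm j (permR ms)) sgn_before_cons.
have -> : rem m (sort leq (j :: s)) = sort leq (j :: rem m s).
  have mR : is_mono (rem m s) by exact: is_mono_rem.
  apply: mono_eq => [||x]; first exact/is_mono_rem/is_mono_insert.
    by apply: is_mono_insert => //; rewrite mem_rem_uniq // inE (negPf js) andbF.
  rewrite mem_rem_uniq ?sort_uniq /= ?js // inE !mem_sort !inE mem_rem_uniq // inE.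
  by case: eqVneq => //= ->; rewrite (negPf nmj).
rewrite (sgn_ltn_anti nmj) !mulNr opprK !mulrA; congr (_ * _).
by rewrite -[RHS]mulrA mulrACA -expr2 sqrr_sign mul1r mulrC.
Qed.

End DualAction.

(** * Weights of Lie words *)

Section LieWords.
Local Open Scope ring_scope.
Variable K : fieldType.
Local Notation X := (@Xact K).

(** * The transposed pivot elements *)

Lemma act_pref i k phi :
  act (pref K i k) phi = Xprod X (rev (pref_seq i k)) phi.
Proof.
rewrite /pref /pref_seq; elim: (iota 0 k) phi => [|n s IH] phi; first exact: act_id.
have pS := @preserves_mono_foldr K i s.
rewrite /= act_comp; last by apply: preserves_mono_comp pS; exact: preserves_mono_xop.
rewrite act_comp; last exact: pS.
by rewrite IH !rev_cons -!cats1 !Xprod_cat.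
Qed.

Definition vterm i k : dual K -> dual K :=
  fun phi => act (dop K (i + 3 * k)) (Xprod X (rev (pref_seq i k)) phi).

(** The product has [2k] factors, so [X j] passes it without a sign; the minus sign and the delta
    term come from the derivation alone. *)
Lemma vterm_Xact i k j phi :
  vterm i k (X j phi) =
  - X j (vterm i k phi) + (i + 3 * k == j)%:R *: Xprod X (rev (pref_seq i k)) phi.
Proof.
rewrite /vterm -dop_Xact X_Xprod; last exact: Xact_anti.
by rewrite size_rev size_pref_seq -signr_odd mul2n odd_double scale1r.
Qed.

Lemma sum_iota_widen (F : nat -> K) n N : (n <= N)%N ->
  (forall k, (n <= k)%N -> F k = 0) ->
  \sum_(k <- iota 0 n) F k = \sum_(k <- iota 0 N) F k.
Proof.
move=> /subnKC <- F0; rewrite iotaD big_cat /= [X in _ + X]big1_seq ?addr0 //.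
by move=> k; rewrite mem_iota => /andP[_ /andP[/F0]].
Qed.

Lemma mem_leq_sumn (s : seq nat) x : x \in s -> (x <= sumn s)%N.
Proof.
elim: s => //= y s IH; rewrite inE => /orP[/eqP ->|/IH h]; first exact: leq_addr.
exact: leq_trans h (leq_addl _ _).
Qed.

(** The truncation in [vop] depends on the monomial. Later terms vanish, so any larger bound may be
    used, and sums at different monomials become comparable. *)
Lemma act_vop i phi (S : smono) N : (sumn (val S) < N)%N ->
  act (vop K i) phi S = \sum_(k <- iota 0 N) (vterm i k phi S : K).
Proof.
move=> ltN; rewrite -(sum_iota_widen ltN) => [|k ltk].
  rewrite {1}/act /vop big_flatten big_map; apply: eq_bigr => k _.
  rewrite /vterm -act_pref -act_comp //.
  exact: preserves_mono_dop.
rewrite /vterm act_dop; case: ifPn => // /mem_leq_sumn; lia.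
Qed.

(* The possible monomials [x_A] in the image of [x_i] under a derivation of
   parity [b] whose weight, evaluated at [f], is [d f]. *)
Definition graded (d : (nat -> nat) -> nat) (b : bool) (i : nat) (A : seq nat) : Prop :=
  [/\ uniq A, pivot_shape A i, odd (size A) = ~~ b &
    forall f, pivot_rec f -> (d f + \sum_(a <- A) f a)%N = f i].

(** Weights add because the deleted [x_j] is replaced by a monomial [B] with [d f] plus the weight
    of [B] equal to [f j]. The shape comes from [pivot_shape_comp]. *)
Lemma graded_comp d d' d'' b b' b'' i A C :
    (forall f, d'' f = d f + d' f)%N -> b'' = b (+) b' ->
  graded d' b' i A -> contracted (graded d b) A C -> uniq C -> graded d'' b'' i C.
Proof.
move=> dE -> [uA sA oA wA] [j [B [jA [uB sB oB wB] pC]]] uC.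
have uBA : uniq (B ++ rem j A) by rewrite -(perm_uniq pC).
have memR x : (x \in rem j A) = (x != j) && (x \in A) by rewrite mem_rem_uniq.
split=> //.
- apply: (pivot_shape_comp sB sA jA) => [x xB xA|x].
    apply: contraTeq uBA => xj; rewrite cat_uniq negb_and negb_and negbK.
    by apply/orP; right; apply/orP; left; apply/hasP; exists x; rewrite // memR xj.
  by rewrite (perm_mem pC) mem_cat memR andbC.
- rewrite (perm_size pC) size_cat size_rem // oddD oB.
  case: (A) jA oA => //= a A' _; rewrite -[RHS]negbK => /negbRL ->.
  by case: (b); case: (b').
move=> f fr; rewrite dE (perm_big _ pC) big_cat /=.
have := wA f fr; rewrite (perm_big _ (perm_to_rem jA)) big_cons /=.
have := wB f fr; lia.
Qed.

Definition wdot (w : lword) (f : nat -> nat) : nat :=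
  let: (a, b, c) := mdeg w in (a * f 0 + b * f 1 + c * f 2)%N.

Lemma wdot_LBr a b f : wdot (LBr a b) f = (wdot a f + wdot b f)%N.
Proof.
rewrite /wdot /=; case: (mdeg a) => [[a1 a2] a3]; case: (mdeg b) => [[b1 b2] b3].
lia.
Qed.

Lemma wdot_LSq a f : wdot (LSq a) f = (wdot a f + wdot a f)%N.
Proof. by rewrite /wdot /=; case: (mdeg a) => [[a1 a2] a3]; lia. Qed.

Lemma tdeg_LBr a b : tdeg (LBr a b) = (tdeg a + tdeg b)%N.
Proof.
rewrite /tdeg /=; case: (mdeg a) => [[a1 a2] a3]; case: (mdeg b) => [[b1 b2] b3].
lia.
Qed.

Lemma tdeg_LSq a : tdeg (LSq a) = (tdeg a).*2.
Proof. by rewrite /tdeg /=; case: (mdeg a) => [[a1 a2] a3]; lia. Qed.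

Lemma superder_ext P b (D E : dual K -> dual K) :
  D =1 E -> superder X P b D -> superder X P b E.
Proof.
move=> DE dD i; have [L sL DL] := dD i.
by exists L => // v; rewrite -!DE DL.
Qed.

Lemma graded_pref (i : 'I_3) k :
  graded (wdot (LGen i)) true (i + 3 * k) (rev (pref_seq i k)).
Proof.
split.
- by rewrite rev_uniq uniq_pref_seq.
- have [n [l [e P H]]] := pivot_shape_pref i k.
  by exists n, l; split=> // [x /P|]; [|case: H => H; [left|right] => x];
    rewrite mem_rev //; exact: H.
- by rewrite size_rev size_pref_seq mul2n odd_double.
move=> f fr; rewrite (perm_big (pref_seq i k)) ?perm_rev //= -(sum_pref_seq i k fr).
congr addn; rewrite /wdot /=; case: i => -[|[|[|]]] //= _; lia.
Qed.

Lemma superder_vop (i : 'I_3) :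
  superder X (graded (wdot (LGen i)) true) true (act (vop K i)).
Proof.
move=> j; pose A k := rev (pref_seq i k).
pose s := [seq (1 : K, A k) | k <- iota 0 j.+1 & (i + 3 * k == j)%N].
exists (fun v => \sum_(p <- s) p.1 *: Xprod X p.2 v).
  exists s => // p /mapP[k]; rewrite mem_filter => /andP[/eqP <- _] ->.
  exact: graded_pref.
move=> v; apply/funext => S; rewrite dual_addE dual_scaleE expr1 mulN1r.
(* [N] exceeds [j] and the index sums of both [val S] and [j :: val S], so one range serves every
   sum below. *)
pose N := (sumn (val S) + j).+1.
have sE : (\sum_(p <- s) p.1 *: Xprod X p.2 v) S =
    \sum_(k <- iota 0 N) (i + 3 * k == j)%N%:R * (Xprod X (A k) v S : K).
  rewrite fct_sumE /s big_map big_filter big_mkcond /=.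
  rewrite -(@sum_iota_widen _ j.+1 N) /N; [|lia|]; last first.
    by move=> k ltk; case: eqP => [|_]; [lia|rewrite mul0r].
  by apply: eq_bigr => k _; case: eqP => _; rewrite ?scale1r ?mul1r ?mul0r.
rewrite sE (@act_vop _ _ _ N); last by rewrite /N; lia.
have -> : X j (act (vop K i) v) S = \sum_(k <- iota 0 N) (X j (vterm i k v) S : K).
  rewrite XactE; case: (boolP (j \in val S)) => jS.
    by rewrite big1 // => k _; rewrite XactE jS.
  rewrite (@act_vop _ _ _ N); last first.
    rewrite to_smonoK ?is_mono_insert ?(valP S) // /N.
    by rewrite (perm_sumn (_ : perm_eq _ (j :: val S))) ?perm_sort //= addnC.
  rewrite mulr_sumr; apply: eq_bigr => k _.
  by rewrite XactE (negPf jS).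
rewrite -sumrN -big_split; apply: eq_bigr => k _ /=.
by rewrite vterm_Xact.
Qed.

(** The third invariant says, transposed, that the operator kills the constant 1; supercommutators
    with the [X i] alone would not exclude multiplication operators. *)
Lemma superder_eval w : wf w ->
  [/\ preserves_mono (eval K w),
      superder X (graded (wdot w) (odd (tdeg w))) (odd (tdeg w)) (act (eval K w)) &
      forall phi, act (eval K w) phi smono_nil = 0].
Proof.
elim: w => [i _|a IHa b IHb /= /andP[/IHa[pa da na] /IHb[pb db nb]]|
            a IHa /= /andP[/IHa[pa da na] oa]].
- have -> : odd (tdeg (LGen i)) = true.
    by rewrite /tdeg /=; case: i => -[|[|[|]]].
  split; [exact: preserves_mono_vop|exact: superder_vop|].
  move=> phi; rewrite (@act_vop _ _ _ 1) // big_seq1.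
  by rewrite /vterm act_dop.
- have pab := preserves_mono_comp pa pb; have pba := preserves_mono_comp pb pa.
  (* Transposition exchanges [a] and [b] in the bracket; the sign is symmetric in the two
     parities. *)
  have actE phi : act (eval K (LBr a b)) phi = act (eval K b) (act (eval K a) phi) +
      (if odd (tdeg b) && odd (tdeg a) then 1 else -1) *:
        act (eval K a) (act (eval K b) phi).
    by rewrite /= act_add act_scale !act_comp // andbC.
  split=> [S p mS||phi]; last 1 first.
  + by rewrite actE dual_addE dual_scaleE na nb mulr0 addr0.
  + rewrite /= mem_cat => /orP[|/mapP[q]]; first exact: pab.
    by move=> qab ->; exact: pba qab.
  have -> : odd (tdeg (LBr a b)) = odd (tdeg b) (+) odd (tdeg a).
    by rewrite tdeg_LBr oddD addbC.
  apply: superder_ext (fsym actE) _.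
  refine (superder_bracket (@Xact_sq K) (@Xact_anti K) db da _ _ _ _).
  + by move=> i A [].
  + by move=> i A [].
  + move=> i A C; apply: graded_comp => // f; by rewrite wdot_LBr addnC.
  + by move=> i A C; apply: graded_comp => [f|]; [rewrite wdot_LBr|rewrite addbC].
- split=> [||phi]; first exact: preserves_mono_comp; last first.
    by rewrite /= act_comp.
  rewrite tdeg_LSq odd_double oa in da *.
  apply: superder_ext (_ : (fun v => act (eval K a) (act (eval K a) v)) =1 _) _.
    by move=> v; rewrite /= act_comp.
  refine (superder_square (@Xact_sq K) (@Xact_anti K) da _ _).
    by move=> i A [].
  by move=> i A C; apply: graded_comp => // f; rewrite wdot_LSq.
Qed.

(** A superderivation that kills 1 and all generators is zero. The induction strips the least index
    of [S] by trading it for an [X i] applied to the functional. *)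
Lemma superder_nonzero P b (D : dual K -> dual K) phi (S : smono) :
    superder X P b D -> (forall psi, D psi smono_nil = 0) -> D phi S != 0 ->
  exists i A, P i A.
Proof.
move=> dD D0; case: S => s; elim: s phi => [|i s IH] phi mS.
  by rewrite (_ : exist _ _ _ = smono_nil) ?D0 ?eqxx //; exact: val_inj.
have ms : is_mono s by move: mS; rewrite /is_mono /= => /path_sorted.
pose T : smono := exist _ s ms.
have lti : all (ltn i) s by apply: order_path_min mS; exact: ltn_trans.
have XT psi : X i psi T = psi (exist _ (i :: s) mS).
  rewrite XactE /=.
  have iNs : i \notin s by apply/negP => /(allP lti) /=; rewrite ltnn.
  rewrite (negPf iNs) sort_mono // /sgn_before.
  rewrite (_ : count _ _ = 0%N) ?mul1r; last first.
    by apply/eqP; rewrite -leqn0 leqNgt -has_count -all_predC; apply: sub_all lti => x /=; lia.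
  by congr psi; apply: val_inj; rewrite /= to_smonoK.
rewrite -XT; have [L [t tP Lt] DL] := dD i.
(* If this value vanishes, the Leibniz rule makes the contribution of the generator [x_i] nonzero,
   so the list [t] cannot be empty. *)
move=> nz; have [e|/IH//] := eqVneq (D (X i phi) T) 0.
case: t tP Lt => [|p t] tP Lt.
  move/(congr1 (fun u => u T)): (DL phi); rewrite e Lt big_nil dual_addE dual_scaleE.
  rewrite addr0 => /esym/eqP; rewrite mulf_eq0 signr_eq0 /= => e'.
  by rewrite e' in nz.
by exists i, p.2; apply: tP; rewrite mem_head.
Qed.

(** Indicator functionals read off coefficients, so a nonzero operator has a nonzero transpose. *)
Lemma act_indicator A (S w : seq nat) (mS : is_mono S) : preserves_mono A ->
  act A (fun T => (val T == w)%:R : K^o) (exist _ S mS) = coef (A S) w.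
Proof.
move=> pA; rewrite /act /coef [RHS]big_mkcond; apply: eq_big_seq => p pAS.
rewrite to_smonoK; last exact: pA pAS.
by case: eqP => _; rewrite ?mulr1 ?mulr0.
Qed.

Lemma Qcomp_tail n1 n2 n3 : Qcomp_nonzero K (n1, n2, n3) ->
  exists n r, [/\ uniq r, tail_shape n r &
    forall f, pivot_rec f ->
      (n1 * f 0 + n2 * f 1 + n3 * f 2 + \sum_(a <- r) f a = f n)%N].
Proof.
move=> [w [wfw dw [S [u [mS]]]]]; have [pw derw nw] := superder_eval wfw.
rewrite -(act_indicator _ mS pw).
case/(superder_nonzero derw nw) => i [A [uA sA _ wA]].
have [n [r [ur tr H]]] := pivot_shape_tail uA sA.
exists n, r; split=> // f fr; apply: H => //.
by have := wA f fr; rewrite /wdot dw.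
Qed.

End LieWords.

(** * Estimates *)

Open Scope R_scope.

(** The solution of the recurrence with initial values [a], [b], [c], computed by shifting the
    window of three consecutive values. *)
Fixpoint pivot_sol (a b c n : nat) : nat :=
  if n is m.+1 then pivot_sol b c (b + 2 * a) m else a.

Lemma pivot_sol_rec a b c : pivot_rec (pivot_sol a b c).
Proof.
move=> i; rewrite addn3 addn1.
elim: i a b c => [|i IH] a b c /=; [lia|exact: IH].
Qed.

Fixpoint csum (t : C) (r : seq nat) : C :=
  if r is a :: r' then (Cpow t a + csum t r')%C else RtoC 0.

Fixpoint rsum (t : R) (r : seq nat) : R :=
  if r is a :: r' then t ^ a + rsum t r' else 0.

Definition nat3C (x y z : nat) (t : C) : C :=
  (RtoC (INR x) + RtoC (INR y) * t + RtoC (INR z) * (t * t))%C.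

Lemma nat3C_add x y z x' y' z' t :
  nat3C (x + x') (y + y') (z + z') t = (nat3C x y z t + nat3C x' y' z' t)%C.
Proof. by rewrite /nat3C !plus_INR !RtoC_plus; ring. Qed.

(** The three basic solutions are the coordinates of [t^n] with respect to [1], [t], [t^2]. Through
    them, identities between natural-number weights can be evaluated at a real or complex root. *)
Lemma Cpow_pivot_sol (t : C) n : (t * t * t = t + RtoC 2)%C ->
  nat3C (pivot_sol 1 0 0 n) (pivot_sol 0 1 0 n) (pivot_sol 0 0 1 n) t = Cpow t n.
Proof.
move=> Ht.
suff [H _] : let P n := nat3C (pivot_sol 1 0 0 n) (pivot_sol 0 1 0 n)
    (pivot_sol 0 0 1 n) t = Cpow t n in P n /\ P n.+1 /\ P n.+2 by exact: H.
elim: n => [|n [P0 [P1 P2]]].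
  by rewrite /nat3C /=; split; [|split]; ring.
split=> //; split=> //.
have H a b c := pivot_sol_rec a b c n; move: H; rewrite addn3 addn1 => H.
rewrite !H !mul2n -!addnn !nat3C_add P0 P1.
have -> : Cpow t n.+3 = (t * t * t * Cpow t n)%C by rewrite /=; ring.
rewrite Ht; have -> : RtoC 2 = (RtoC 1 + RtoC 1)%C by rewrite -RtoC_plus.
by rewrite /=; ring.
Qed.

Lemma csum_pivot_sol (t : C) r : (t * t * t = t + RtoC 2)%C ->
  nat3C (\sum_(a <- r) pivot_sol 1 0 0 a) (\sum_(a <- r) pivot_sol 0 1 0 a)
    (\sum_(a <- r) pivot_sol 0 0 1 a) t = csum t r.
Proof.
move=> Ht; elim: r => [|a r IH]; first by rewrite !big_nil /nat3C /=; ring.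
by rewrite !big_cons nat3C_add IH Cpow_pivot_sol.
Qed.

Lemma tail_weight n1 n2 n3 n r (t : C) : (t * t * t = t + RtoC 2)%C ->
  (forall f, pivot_rec f ->
     n1 * f 0 + n2 * f 1 + n3 * f 2 + \sum_(a <- r) f a = f n)%N ->
  (nat3C n1 n2 n3 t + csum t r = Cpow t n)%C.
Proof.
move=> Ht H.
rewrite -Cpow_pivot_sol // -csum_pivot_sol // -nat3C_add.
have H1 := H _ (pivot_sol_rec 1 0 0).
have H2 := H _ (pivot_sol_rec 0 1 0).
have H3 := H _ (pivot_sol_rec 0 0 1).
by rewrite -H1 -H2 -H3 /= !muln0 !muln1 !addn0 !add0n.
Qed.

Lemma Cmod_csum t r : Cmod (csum t r) <= rsum (Cmod t) r.
Proof.
elim: r => [|a r IH] /=; first by rewrite Cmod_0; lra.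
apply: Rle_trans (Cmod_triangle _ _) _.
by rewrite Cmod_pow; lra.
Qed.

Lemma RtoC_rsum t r : csum (RtoC t) r = RtoC (rsum t r).
Proof. by elim: r => //= a r ->; rewrite RtoC_plus RtoC_pow. Qed.

(** * Geometric sums over distinct exponents *)

Lemma rsum_rem t (r : seq nat) x : x \in r -> rsum t r = t ^ x + rsum t (rem x r).
Proof.
elim: r => //= a r IH; rewrite inE eq_sym.
by case: eqP => [->//|_] /= /IH ->; lra.
Qed.

(** Induction on [n] removes the largest admissible exponent. The bound is multiplied out to avoid
    division and negative exponents. *)
Lemma rsum_geom t c n (r : seq nat) : 1 <= t -> uniq r ->
  (forall x, x \in r -> x + c.+1 <= n)%N -> (t - 1) * t ^ c * rsum t r <= t ^ n.
Proof.
move=> t1; elim: n r => [|n IH] r ur hr.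
  case: r ur hr => [|a r] _ hr /=; first by lra.
  by have := hr a (mem_head _ _); lia.
have tn : 0 < t ^ n by apply: pow_lt; lra.
have [x_r|x_r] := boolP ((n - c)%N \in r); last first.
  apply: Rle_trans (IH r ur _) _; last by rewrite /=; nra.
  move=> x xr; have := hr x xr; have : x != (n - c)%N by apply: contraNneq x_r => <-.
  lia.
(* Membership forces [c <= n], so the subtraction is not truncated. *)
have := hr _ x_r => le_c.
rewrite (rsum_rem t x_r) Rmult_plus_distr_l.
have -> : (t - 1) * t ^ c * t ^ (n - c) = (t - 1) * t ^ n.
  by rewrite Rmult_assoc -pow_add; congr (_ * t ^ _); lia.
suff: (t - 1) * t ^ c * rsum t (rem (n - c)%N r) <= t ^ n by rewrite /=; lra.
apply: IH; first exact: rem_uniq.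
move=> x; rewrite mem_rem_uniq // inE /= => /andP[ne xr].
by have := hr x xr; lia.
Qed.

(** The two conditions on [k] cover the two tail shapes: [k >= 1/((t-1)t^2)] and
    [k >= 1/t^2 + 1/((t-1)t^4)]. *)
Lemma rsum_tail t k n r : 1 < t -> uniq r -> tail_shape n r ->
  1 <= k * ((t - 1) * t ^ 2) -> 1 <= (k * t ^ 2 - 1) * ((t - 1) * t ^ 2) ->
  rsum t r <= k * t ^ n.
Proof.
move=> t1 ur tr k1 k2.
have tn : 0 < t ^ n by apply: pow_lt; lra.
have t2 : 1 < t ^ 2 by rewrite /=; nra.
have c2 : 0 < (t - 1) * t ^ 2 by apply: Rmult_lt_0_compat; lra.
case: tr => tr.
  have := @rsum_geom t 2 n r (Rlt_le _ _ t1) ur tr => h.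
  by nra.
have [x_r|x_r] := boolP ((n - 2)%N \in r); last first.
  have h := @rsum_geom t 2 n r (Rlt_le _ _ t1) ur _.
  have {}h : (t - 1) * t ^ 2 * rsum t r <= t ^ n.
    apply: h => x xr; case: (tr x xr); last lia.
    by move=> e; move: x_r; rewrite -e addnK xr.
  by nra.
have u' := rem_uniq (n - 2)%N ur.
have h : (t - 1) * t ^ 4 * rsum t (rem (n - 2)%N r) <= t ^ n.
  apply: rsum_geom => //; first lra.
  move=> x; rewrite mem_rem_uniq // inE /= => /andP[ne xr].
  by case: (tr x xr) => //; lia.
have n2 : (2 <= n)%N by case: (tr _ x_r); lia.
have e : t ^ 2 * t ^ (n - 2) = t ^ n by rewrite -pow_add; congr (t ^ _); lia.
rewrite (rsum_rem t x_r).
set y := t ^ (n - 2) in e *; set s := rsum t _ in h *.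
have h' : (t - 1) * t ^ 2 * (t ^ 2 * s) <= t ^ n.
  by apply: Rle_trans h; right; rewrite /=; ring.
have h'' : t ^ 2 * s <= (k * t ^ 2 - 1) * t ^ n by nra.
by nra.
Qed.

(** * The roots of [t^3 - t - 2] *)

Lemma cubic_root_bounds lam : lam ^ 3 - lam - 2 = 0 -> 1.521 < lam < 1.522.
Proof.
move=> H.
(* The cofactor is positive for [a > 1.5], so the sign of the cubic at [a] decides on which side of
   [a] the root lies. *)
have factor a : (lam - a) * (lam ^ 2 + a * lam + a ^ 2 - 1) = - (a ^ 3 - a - 2).
  have -> : (lam - a) * (lam ^ 2 + a * lam + a ^ 2 - 1) =
    lam ^ 3 - lam - 2 - (a ^ 3 - a - 2) by ring.
  by rewrite H; ring.
have pos a : 1.5 < a -> 0 < lam ^ 2 + a * lam + a ^ 2 - 1.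
  by move=> ha; have := pow2_ge_0 (lam + a / 2); nra.
have := pos 1.521 ltac:(lra); have := factor 1.521.
have := pos 1.522 ltac:(lra); have := factor 1.522.
by split; nra.
Qed.

Lemma cubic_root_unique x y : x ^ 3 - x - 2 = 0 -> y ^ 3 - y - 2 = 0 -> x = y.
Proof.
move=> hx hy; have := cubic_root_bounds hx; have := cubic_root_bounds hy => hby hbx.
have : (x - y) * (x ^ 2 + x * y + y ^ 2 - 1) = 0.
  have -> : (x - y) * (x ^ 2 + x * y + y ^ 2 - 1) =
    (x ^ 3 - x - 2) - (y ^ 3 - y - 2) by ring.
  by rewrite hx hy; ring.
by case/Rmult_integral; [lra|nra].
Qed.

(** With [mu = x + iy], the imaginary part of the equation gives [y^2 = 3x^2 - 1]. The real part
    then makes [-2x] a root, hence [lam], and [x^2 + y^2 = 4x^2 - 1]. *)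
Lemma Cmod_sqr_complex_root lam (mu : C) : lam ^ 3 - lam - 2 = 0 ->
  (mu * mu * mu - mu - RtoC 2)%C = RtoC 0 -> 0 < Im mu ->
  Cmod mu ^ 2 = lam ^ 2 - 1.
Proof.
move=> hlam; case: mu => x y; rewrite /Cminus /Cplus /Cmult /Copp /RtoC /=.
case=> hre him hy.
have hy2 : y * y = 3 * (x * x) - 1 by nra.
have -> : lam = - 2 * x.
  apply: cubic_root_unique hlam _; rewrite /=.
  have : x * x * x - 3 * x * (y * y) - x - 2 = 0 by lra.
  by rewrite hy2; lra.
rewrite /Cmod /= !Rmult_1_r sqrt_sqrt; nra.
Qed.

(** Raising to the power [ln rho / ln lam] sends [lam^m] to [rho^m]; the factor with exponent [k]
    stays on the right to avoid [n - k]. *)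
Lemma pow_le_Rpower lam rho Y n k : 1 < lam -> 1 < rho -> 0 < Y ->
  lam ^ n <= Y * lam ^ k -> rho ^ n <= Rpower Y (ln rho / ln lam) * rho ^ k.
Proof.
move=> l1 r1 Y0 h.
have lr : 0 < ln rho by rewrite -ln_1; apply: ln_increasing; lra.
have ll : 0 < ln lam by rewrite -ln_1; apply: ln_increasing; lra.
have ln_h : INR n * ln lam <= ln Y + INR k * ln lam.
  rewrite -!ln_pow; try lra.
  rewrite -ln_mult //; last by apply: pow_lt; lra.
  apply: ln_le => //; apply: pow_lt; lra.
rewrite -!Rpower_pow; try lra.
rewrite /Rpower -exp_plus.
apply: Rnot_lt_le => /exp_lt_inv; apply: Rle_not_lt.
have -> : ln rho / ln lam * ln Y + INR k * ln rho =
  ln rho / ln lam * (ln Y + INR k * ln lam) by field; lra.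
have -> : INR n * ln rho = ln rho / ln lam * (INR n * ln lam) by field; lra.
apply: Rmult_le_compat_l => //; apply: Rlt_le; exact: Rdiv_lt_0_compat.
Qed.

Theorem theorem8p5 (K : fieldType) (lam : R) (mu : C)
  (Hlam : lam ^ 3 - lam - 2 = 0)
  (Hmu : (mu * mu * mu - mu - RtoC 2)%C = RtoC 0)
  (Hmu_im : 0 < Im mu)
  (n1 n2 n3 : nat) (HQ : Qcomp_nonzero K (n1, n2, n3)) :
  let sigma := ln lam / ln (Cmod mu) in
  let Y1 := INR n1 + INR n2 * lam + INR n3 * lam ^ 2 in
  let z := (RtoC (INR n1) + RtoC (INR n2) * mu + RtoC (INR n3) * (mu * mu))%C in
  let Y2 := Re z in
  let Y3 := Im z in
  sqrt (Y2 ^ 2 + Y3 ^ 2) < 14 * Rpower Y1 (1 / sigma).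
Proof.
move=> sigma Y1 z Y2 Y3.
change (Cmod z < 14 * Rpower Y1 (1 / sigma)).
have [lam1 lam2] := cubic_root_bounds Hlam.
have rho2 := Cmod_sqr_complex_root Hlam Hmu Hmu_im.
have rho0 := Cmod_ge_0 mu.
set rho := Cmod mu in rho0 rho2 *.
have [rho_gt rho_lt] : 1.146 < rho < 1.1475 by split; nra.
have [n [r [ur tr wr]]] := Qcomp_tail HQ.
have Hmu' : (mu * mu * mu = mu + RtoC 2)%C.
  have -> : (mu * mu * mu = (mu * mu * mu - mu - RtoC 2) + (mu + RtoC 2))%C by ring.
  by rewrite Hmu; ring.
have Hlam' : (RtoC lam * RtoC lam * RtoC lam = RtoC lam + RtoC 2)%C.
  by rewrite -!RtoC_mult -RtoC_plus; congr RtoC; lra.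
have zE : (z + csum mu r = Cpow mu n)%C := tail_weight Hmu' wr.
have Y1E : Y1 + rsum lam r = lam ^ n.
  apply: RtoC_inj; rewrite RtoC_plus RtoC_pow -RtoC_rsum -(tail_weight Hlam' wr).
  by rewrite /nat3C /Y1 !RtoC_plus !RtoC_mult /=; ring.
have lam_n : 0 < lam ^ n by apply: pow_lt; lra.
have rho_n : 0 < rho ^ n by apply: pow_lt; lra.
(* For both roots the first tail shape is decisive: [1/((t-1)t^2)] is about 0.83 at [lam] and 5.2 at
   [rho]. *)
have sum_lam : rsum lam r <= 0.87 * lam ^ n.
  by apply: rsum_tail => //; [lra|nra|nra].
have sum_rho : rsum rho r <= 5.5 * rho ^ n.
  by apply: rsum_tail => //; [lra|nra|nra].
have z_le : Cmod z <= 6.5 * rho ^ n.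
  have -> : z = (Cpow mu n + - csum mu r)%C by rewrite -zE; ring.
  apply: Rle_trans (Cmod_triangle _ _) _; rewrite Cmod_opp Cmod_pow -/rho.
  by have := Cmod_csum mu r; rewrite -/rho; lra.
have Y1_pos : 0 < Y1 by lra.
(* The tail bound leaves [Y1 >= 0.13 * lam^n], and [0.13 * 8 > 1], so five powers of [lam] absorb
   the constant. *)
have lam5 : 8 <= lam ^ 5 by rewrite /=; nra.
have Y1_ge : lam ^ n <= Y1 * lam ^ 5 by nra.
have -> : 1 / sigma = ln rho / ln lam.
  rewrite /sigma -/rho; field; split; apply: Rgt_not_eq; rewrite -ln_1;
    apply: ln_increasing; lra.
have lam_gt1 : 1 < lam by lra.
have rho_gt1 : 1 < rho by lra.
have := pow_le_Rpower lam_gt1 rho_gt1 Y1_pos Y1_ge.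
set p := Rpower _ _ => p_ge.
(* The final constant is then below [6.5 * 2 = 13]. *)
have rho5 : 0 < rho ^ 5 < 2.
  split; first by apply: pow_lt; lra.
  have -> : rho ^ 5 = rho * (rho ^ 2 * rho ^ 2) by ring.
  have w_lt : 0 < rho ^ 2 < 1.317 by nra.
  have ww_lt : 0 < rho ^ 2 * rho ^ 2 < 1.735 by nra.
  by nra.
by nra.
Qed.
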